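(* Let $(\mathfrak{g},\phi_\mathfrak{g})$ be a LeibDer pair and $(M,\phi_M)$ a representation of it. Let $Ext(\mathfrak{g},M)$ denote the set of equivalence classes of abelian extensions of $(\mathfrak{g},\phi_\mathfrak{g})$ by $(M,\phi_M)$. There is a bijection $Ext(\mathfrak{g},M)\cong H^2_{\mathrm{LeibDer}}(\mathfrak{g},M)$.
   Context: All vector spaces and linear maps are over a field $\mathbb{K}$ of characteristic zero. A (right) Leibniz algebra is a vector space $\mathfrak{g}$ with a bilinear bracket satisfying $[[x,y],z]=[[x,z],y]+[x,[y,z]]$. A LeibDer pair $(\mathfrak{g},\phi_\mathfrak{g})$ is a Leibniz algebra with a derivation $\phi_\mathfrak{g}$ ($\phi_\mathfrak{g}[x,y]=[\phi_\mathfrak{g}(x),y]+[x,\phi_\mathfrak{g}(y)]$); a morphism of LeibDer pairs is a Leibniz algebra morphism commuting with the derivations. A representation of a Leibniz algebra $\mathfrak{g}$ is a vector space $M$ with bilinear maps $[\,,]:\mathfrak{g}\times M\to M$, $[\,,]:M\times\mathfrak{g}\to M$ such that $[[m,x],y]=[[m,y],x]+[m,[x,y]]$, $[[x,m],y]=[[x,y],m]+[x,[m,y]]$, $[[x,y],m]=[[x,m],y]+[x,[y,m]]$. A representation $(M,\phi_M)$ of a LeibDer pair is such an $M$ with a linear map $\phi_M:M\to M$ satisfying $\phi_M[x,m]=[\phi_\mathfrak{g}(x),m]+[x,\phi_M(m)]$ and $\phi_M[m,x]=[\phi_M(m),x]+[m,\phi_\mathfrak{g}(x)]$. $(M,\phi_M)$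 is also viewed as a LeibDer pair with zero bracket. An abelian extension of $(\mathfrak{g},\phi_\mathfrak{g})$ by $(M,\phi_M)$ is a short exact sequence of LeibDer pairs $0\to(M,\phi_M)\xrightarrow{i}(\mathfrak{h},\phi_\mathfrak{h})\xrightarrow{p}(\mathfrak{g},\phi_\mathfrak{g})\to0$ that is split over $\mathbb{K}$ by a linear section $s:\mathfrak{g}\to\mathfrak{h}$ ($p\circ s=\mathrm{id}_\mathfrak{g}$), and such that the given representation is induced by the extension: $[x,m]=[s(x),i(m)]$ and $[m,x]=[i(m),s(x)]$ (identifying $M$ with $i(M)$). Two abelian extensions $\mathfrak{h},\mathfrak{h}'$ are equivalent if there is a morphism of LeibDer pairs $\Psi:(\mathfrak{h},\phi_\mathfrak{h})\to(\mathfrak{h}',\phi_{\mathfrak{h}'})$ with $\Psi\circ i=i'$, $p'\circ\Psi=p$. Cohomology: for $f\in\mathrm{Hom}(\mathfrak{g}^{\otimes n},M)$, $$(\delta_Lf)(x_1,\ldots,x_{n+1})=[x_1,f(x_2,\ldots,x_{n+1})]+\sum_{i=2}^{n+1}(-1)^i[f(x_1,\ldots,\widehat{x_i},\ldots,x_{n+1}),x_i]+\sum_{i<j}(-1)^{j+1}f(x_1,\ldots,x_{i-1},[x_i,x_j],x_{i+1},\ldots,\widehat{x_j},\ldots,x_{n+1}),$$ $$\delta f=\sum_{i=1}^nf\circ(\mathrm{id}\otimes\cdots\otimes\phi_\mathfrak{g}\otimes\cdots\otimes\mathrm{id})-\phi_M\circ f\quad(\phi_\mathfrak{g}\text{ in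 the }i\text{-th place}).$$ Put $C^0_{\mathrm{LeibDer}}=0$, $C^1_{\mathrm{LeibDer}}(\mathfrak{g},M)=\mathrm{Hom}(\mathfrak{g},M)$, $C^n_{\mathrm{LeibDer}}(\mathfrak{g},M)=\mathrm{Hom}(\mathfrak{g}^{\otimes n},M)\times\mathrm{Hom}(\mathfrak{g}^{\otimes n-1},M)$ for $n\ge2$, with $\partial f=(\delta_Lf,-\delta f)$ on $C^1_{\mathrm{LeibDer}}$ and $\partial(f_n,\overline f_n)=(\delta_Lf_n,\delta_L\overline f_n+(-1)^n\delta f_n)$ for $n\ge2$. $H^n_{\mathrm{LeibDer}}(\mathfrak{g},M)$ is the $n$-th cohomology of this complex. *)

(* Defs.v *)
From HB Require Import structures.
From mathcomp Require Import all_boot all_order all_algebra.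
From mathcomp Require Import boolp classical_sets functions.
Set Implicit Arguments.
Unset Strict Implicit.
Unset Printing Implicit Defensive.
Import GRing.Theory.
Local Open Scope classical_set_scope.
Local Open Scope ring_scope.

Record leibnizAlg (K : fieldType) := LeibnizAlg {
  leib_sort :> lmodType K;
  leib_br : {bilinear leib_sort -> leib_sort -> leib_sort};
  leib_identity : forall x y z : leib_sort,
    leib_br (leib_br x y) z = leib_br (leib_br x z) y + leib_br x (leib_br y z)
}.
Arguments leib_br {K l}.

Record leibDer (K : fieldType) := LeibDer {
  ld_alg :> leibnizAlg K;
  ld_der : {linear ld_alg -> ld_alg};
  ld_derivation : forall x y : ld_alg,
    ld_der (leib_br x y) = leib_br (ld_der x) y + leib_br x (ld_der y)
}.
Arguments ld_der {K l}.

Record leibDerHom (K : fieldType) (g h : leibDer K) := LeibDerHom {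
  ldhom_fun :> {linear g -> h};
  ldhom_br : forall x y : g,
    ldhom_fun (leib_br x y) = leib_br (ldhom_fun x) (ldhom_fun y);
  ldhom_der : forall x : g, ldhom_fun (ld_der x) = ld_der (ldhom_fun x)
}.

Record leibRep (K : fieldType) (g : leibnizAlg K) := LeibRep {
  rep_sort :> lmodType K;
  lact : {bilinear g -> rep_sort -> rep_sort};
  ract : {bilinear rep_sort -> g -> rep_sort};
  rep_MLL : forall (m : rep_sort) (x y : g),
    ract (ract m x) y = ract (ract m y) x + ract m (leib_br x y);
  rep_LML : forall (x : g) (m : rep_sort) (y : g),
    ract (lact x m) y = lact (leib_br x y) m + lact x (ract m y);
  rep_LLM : forall (x y : g) (m : rep_sort),
    lact (leib_br x y) m = ract (lact x m) y + lact x (lact y m)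
}.
Arguments lact {K g l}.
Arguments ract {K g l}.

Record leibDerRep (K : fieldType) (g : leibDer K) := LeibDerRep {
  ldr_rep :> leibRep g;
  ldr_map : {linear ldr_rep -> ldr_rep};
  ldr_lact : forall (x : g) (m : ldr_rep),
    ldr_map (lact x m) = lact (ld_der x) m + lact x (ldr_map m);
  ldr_ract : forall (m : ldr_rep) (x : g),
    ldr_map (ract m x) = ract (ldr_map m) x + ract m (ld_der x)
}.
Arguments ldr_map {K g l}.

Section ZeroBracket.
Variables (K : fieldType) (V : lmodType K) (phi : {linear V -> V}).

Definition zero_br (_ _ : V) : V := 0.

Lemma zero_br_bilinear : bilinear_for *:%R *:%R zero_br.
Proof. by split=> [u|u] a x y; rewrite /= /zero_br scaler0 addr0. Qed.

HB.instance Definition _ :=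
  bilinear_isBilinear.Build K V V V *:%R *:%R zero_br zero_br_bilinear.

Lemma zero_br_identity (x y z : V) :
  zero_br (zero_br x y) z = zero_br (zero_br x z) y + zero_br x (zero_br y z).
Proof. by rewrite /zero_br addr0. Qed.

Definition zero_leibnizAlg : leibnizAlg K :=
  @LeibnizAlg K V zero_br zero_br_identity.

Lemma zero_br_derivation (x y : V) :
  phi (zero_br x y) = zero_br (phi x) y + zero_br x (phi y).
Proof. by rewrite /zero_br linear0 addr0. Qed.

Definition zero_leibDer : leibDer K :=
  @LeibDer K zero_leibnizAlg phi zero_br_derivation.

End ZeroBracket.

Definition rep_pair (K : fieldType) (g : leibDer K) (M : leibDerRep g) :
  leibDer K := zero_leibDer (@ldr_map K g M).

Record abelianExt (K : fieldType) (g : leibDer K) (M : leibDerRep g) :=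
    AbelianExt {
  ext_mid : leibDer K;
  ext_i : leibDerHom (rep_pair M) ext_mid;
  ext_p : leibDerHom ext_mid g;
  ext_inj : injective ext_i;
  ext_exact : forall u : ext_mid, ext_p u = 0 <-> exists m, ext_i m = u;
  ext_surj : forall x : g, exists u, ext_p u = x;
  ext_split : exists s : {linear g -> ext_mid},
    [/\ forall x : g, ext_p (s x) = x,
        forall (x : g) (m : M), ext_i (lact x m) = leib_br (s x) (ext_i m)
      & forall (m : M) (x : g), ext_i (ract m x) = leib_br (ext_i m) (s x)]
}.

Definition ext_equiv (K : fieldType) (g : leibDer K) (M : leibDerRep g)
    (E E' : abelianExt M) : Prop :=
  exists Psi : leibDerHom (ext_mid E) (ext_mid E'),
    (forall m, Psi (ext_i E m) = ext_i E' m) /\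
    (forall u, ext_p E' (Psi u) = ext_p E u).

(* Equivalence classes; [abelianExt M] lives in too large a universe for
   [set (abelianExt M)]. *)
Definition Ext (K : fieldType) (g : leibDer K) (M : leibDerRep g) :=
  {A : abelianExt M -> Prop | exists E, A = ext_equiv E}.

Section Cohomology.
Variables (K : fieldType) (g : leibDer K) (M : leibDerRep g).

Definition subst_at n (x : {ffun 'I_n -> g}) (i : 'I_n) (u : g) :
    {ffun 'I_n -> g} :=
  [ffun k => if k == i then u else x k].

Definition drop_at n (x : {ffun 'I_n.+1 -> g}) (i : 'I_n.+1) :
    {ffun 'I_n -> g} :=
  [ffun k => x (lift i k)].

(* Hom(g^{(x) n}, M) is the set of multilinear elements of [mfun n]. *)
Definition mfun n : lmodType K := {ffun 'I_n -> g} -> M.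

Definition multilinear n (f : mfun n) : Prop :=
  forall (x : {ffun 'I_n -> g}) (i : 'I_n) (a : K) (u v : g),
    f (subst_at x i (a *: u + v)) =
    a *: f (subst_at x i u) + f (subst_at x i v).

(* Arguments are numbered from 0, so that the argument x_i of the usual
   formula is [x (i - 1)]; this shifts the exponents of the signs by one. *)
Definition deltaL n (f : mfun n) : mfun n.+1 := fun x =>
    lact (x ord0) (f (drop_at x ord0))
  + \sum_(i < n.+1 | (0 < i)%N) (-1) ^+ i.+1 *: ract (f (drop_at x i)) (x i)
  + \sum_(j < n.+1) \sum_(i < n.+1 | (i < j)%N)
      (-1) ^+ j.+2 *: f (drop_at (subst_at x i (leib_br (x i) (x j))) j).

Definition delta n (f : mfun n) : mfun n := fun x =>
  \sum_(i < n) f (subst_at x i (ld_der (x i))) - ldr_map (f x).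

(* The cochain space C^n is the subspace [cochain n] of [precochain n];
   'rV_0 stands for the zero space. *)
Definition precochain (n : nat) : lmodType K :=
  match n with
  | 0 => 'rV[K]_0
  | 1 => mfun 1
  | m.+2 => (mfun m.+2 * mfun m.+1)%type
  end.

Definition cochain (n : nat) : set (precochain n) :=
  match n with
  | 0 => setT
  | 1 => [set f | multilinear f]
  | m.+2 => [set f | multilinear f.1 /\ multilinear f.2]
  end.

Definition partial (n : nat) : precochain n -> precochain n.+1 :=
  match n with
  | 0 => fun=> 0
  | 1 => fun f => (deltaL f, - delta f)
  | m.+2 => fun f => (deltaL f.1, deltaL f.2 + (-1) ^+ m.+2 *: delta f.1)
  end.

Definition cocycle (n : nat) : set (precochain n) :=
  [set c | cochain c /\ partial c = 0].

Definition coboundary (n : nat) : set (precochain n) :=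
  match n with
  | 0 => [set 0]
  | m.+1 => @partial m @` @cochain m
  end.

(* H^n = Z^n / B^n, as the set of cosets of B^n in Z^n. *)
Definition cohomology (n : nat) :=
  {A : set (precochain n) |
    exists2 c, @cocycle n c & A = [set c + b | b in @coboundary n]}.

End Cohomology.

(* Main.v *)
Require Import Defs.
From HB Require Import structures.
From mathcomp Require Import all_boot all_order all_algebra.
From mathcomp Require Import boolp classical_sets functions.

(** An abelian extension with a linear section [s] is, as a vector space,
    [g + M] by way of [(x, m) |-> s x + i m], and in these coordinates its
    structure is determined by two maps: the factor set [f], given by
    [s x, s y] = s [x, y] + i (f x y), and [e], given by
    phi (s x) = s (phi x) + i (e x) ([br_coordinates], [der_coordinates]).
    The Leibniz identity and the derivation rule of the extension then say
    exactly that [(f, e)] is a 2-cocycle ([factor_set_cocycle]); conversely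
    every 2-cocycle defines a bracket and a derivation on [g * M]
    ([cocycle_extension]).

    Two sections of one extension differ by [i \o t] for some linear
    [t : g -> M], and replacing [s] by [s + i \o t] adds the coboundary of [t]
    to [(f, e)] ([factor_set_shift]).  Hence the set of the factor sets of all
    sections of an extension is one coset of the coboundaries
    ([factor_sets_coset]), that is, a class in the second cohomology.

    This coset is a complete invariant of the extension up to equivalence
    ([ext_equivP]).  An equivalence carries sections to sections with the same
    factor set; in the other direction, if [s] and [s'] have the same factor
    set, then s x + i m |-> s' x + i' m is an equivalence, because the
    structure of both sides is given by the same formulas in coordinates.  In
    particular [ext_equiv] is an equivalence relation, being the kernel of a
    map, and the bijection sends the class of an extension to its coset. *)

Set Implicit Arguments.
Unset Strict Implicit.
Unset Printing Implicit Defensive.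
Import GRing.Theory.
Local Open Scope classical_set_scope.
Local Open Scope ring_scope.

(** * Linear and bilinear maps from their laws *)

Lemma linear_bundle (K : fieldType) (U V : lmodType K) (f : U -> V) :
  linear f -> exists F : {linear U -> V}, F =1 f.
Proof.
move=> lf; pose F : {linear U -> V} :=
  HB.pack f (GRing.isLinear.Build K U V *:%R f lf).
by exists F.
Qed.

Lemma bilinear_bundle (K : fieldType) (U V W : lmodType K) (f : U -> V -> W) :
  bilinear_for *:%R *:%R f -> exists F : {bilinear U -> V -> W}, F =2 f.
Proof.
move=> bf; pose F : {bilinear U -> V -> W} :=
  HB.pack f (bilinear_isBilinear.Build K U V W *:%R *:%R f bf).
by exists F.
Qed.

(** * The complex in low degrees *)

(** Cochains take finite functions as arguments; writing these as sequences
    makes the substitutions and deletions in the differential compute. *)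
Definition args (V : zmodType) n (s : seq V) : {ffun 'I_n -> V} :=
  [ffun k : 'I_n => s`_k].

Notation app1 f x := (f (args 1 [:: x])).
Notation app2 f x y := (f (args 2 [:: x; y])).

Lemma args_ind (V : zmodType) n (P : {ffun 'I_n -> V} -> Prop) :
  (forall s, size s = n -> P (args n s)) -> forall x, P x.
Proof.
move=> Pargs x; suff -> : x = args n (codom x).
  by apply: Pargs; rewrite size_codom card_ord.
apply/ffunP=> k; rewrite ffunE /codom /image_mem (nth_map k) ?size_enum_ord //.
by rewrite nth_ord_enum.
Qed.

Section LowDegree.
Variables (K : fieldType) (g : leibDer K) (M : leibDerRep g).

Lemma subst_at_args n (s : seq g) (i : 'I_n) u :
  subst_at (args n s) i u = args n (set_nth 0 s i u).
Proof. by apply/ffunP=> k; rewrite !ffunE nth_set_nth /= val_eqE. Qed.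

Lemma drop_at_args n (s : seq g) (i : 'I_n.+1) : size s = n.+1 ->
  drop_at (args n.+1 s) i = args n (take i s ++ drop i.+1 s).
Proof.
move=> ss; apply/ffunP=> k; rewrite !ffunE nth_cat size_take ss ltn_ord /=.
rewrite /bump; case: leqP => ik; last by rewrite nth_take.
by rewrite nth_drop addSn subnKC // add1n.
Qed.

Lemma mfunP n (f f' : mfun M n) :
  (forall s, size s = n -> f (args n s) = f' (args n s)) -> f = f'.
Proof. by move=> eqf; apply/funext; apply: args_ind. Qed.

Lemma multilinear1P (f : mfun M 1) :
  multilinear f <-> linear (fun x => app1 f x).
Proof.
split=> [mf a u v|lf].
  by have := mf (args 1 [:: 0]) ord0 a u v; rewrite !subst_at_args.
elim/args_ind=> [[|x []]] //= _ i a u v.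
by rewrite ord1 !subst_at_args /= lf.
Qed.

Lemma multilinear2P (f : mfun M 2) :
  multilinear f <-> bilinear_for *:%R *:%R (fun x y => app2 f x y).
Proof.
split=> [mf|[lfl lfr]].
  split=> [y|x] a u v /=.
    by have := mf (args 2 [:: 0; y]) ord0 a u v; rewrite !subst_at_args.
  have := mf (args 2 [:: x; 0]) (lift ord0 ord0) a u v.
  by rewrite !subst_at_args.
elim/args_ind=> [[|x [|y []]]] //= _ i a u v; rewrite !subst_at_args.
by case: i => [[|[|//]]] i2 /=; [exact: lfl | exact: lfr].
Qed.

Lemma deltaL1E (f : mfun M 1) x y : app2 (deltaL f) x y =
  lact x (app1 f y) + ract (app1 f x) y - app1 f (leib_br x y).
Proof.
rewrite /deltaL big_mkcond !big_ord_recl !big_ord0.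
rewrite ![\sum_(i < _ | (i < _)%N) _]big_mkcond !big_ord_recl !big_ord0 /=.
rewrite !subst_at_args !drop_at_args //= !ffunE /= /bump /=.
by rewrite !(exprS, expr0, mulN1r, opprK, scaleN1r, scale1r, add0r, addr0).
Qed.

Lemma deltaL2E (f : mfun M 2) x y z : deltaL f (args 3 [:: x; y; z]) =
  lact x (app2 f y z) + ract (app2 f x z) y - ract (app2 f x y) z
  - app2 f (leib_br x y) z + app2 f (leib_br x z) y + app2 f x (leib_br y z).
Proof.
rewrite /deltaL big_mkcond !big_ord_recl !big_ord0.
rewrite ![\sum_(i < _ | (i < _)%N) _]big_mkcond !big_ord_recl !big_ord0 /=.
rewrite !subst_at_args !drop_at_args //= !ffunE /= /bump /=.
rewrite !(exprS, expr0, mulN1r, opprK, scaleN1r, scale1r, add0r, addr0).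
by rewrite !addrA.
Qed.

Lemma delta1E (f : mfun M 1) x :
  app1 (delta f) x = app1 f (ld_der x) - ldr_map (app1 f x).
Proof. by rewrite /delta big_ord1 subst_at_args ffunE. Qed.

Lemma delta2E (f : mfun M 2) x y : app2 (delta f) x y =
  app2 f (ld_der x) y + app2 f x (ld_der y) - ldr_map (app2 f x y).
Proof.
by rewrite /delta !big_ord_recl big_ord0 addr0 !subst_at_args !ffunE.
Qed.

(** The two equations are written without subtraction, in the order in which
    the Leibniz identity and the derivation rule of an extension produce their
    terms; the first is [deltaL c.1 = 0], the second
    [deltaL c.2 + delta c.1 = 0]. *)
Lemma cocycle2P (c : precochain M 2) : cocycle c <->
  [/\ bilinear_for *:%R *:%R (fun x y => app2 c.1 x y),
      linear (fun x => app1 c.2 x),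
      forall x y z,
        app2 c.1 (leib_br x y) z + ract (app2 c.1 x y) z =
          (app2 c.1 (leib_br x z) y + ract (app2 c.1 x z) y)
          + (app2 c.1 x (leib_br y z) + lact x (app2 c.1 y z))
    & forall x y,
        app1 c.2 (leib_br x y) + ldr_map (app2 c.1 x y) =
          (lact x (app1 c.2 y) + ract (app1 c.2 x) y)
          + (app2 c.1 (ld_der x) y + app2 c.1 x (ld_der y))].
Proof.
have leib3 (V : zmodType) (a b a' b' a'' b'' : V) :
    (b'' + b' - b - a + a' + a'' = 0) <-> (a + b = (a' + b') + (a'' + b'')).
  rewrite [X in X = 0](AC 6 ((5*2)*(6*1)*(4*3))) /= -opprD.
  by split=> [/subr0_eq//|->]; rewrite subrr.
have der2 (V : zmodType) (a b p q : V) :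
    (p - a + (q - b) = 0) <-> (a + b = p + q).
  rewrite addrACA -opprD.
  by split=> [/subr0_eq//|->]; rewrite subrr.
split=> [[[/multilinear2P bf /multilinear1P le] [df de]]|[bf le leibf dere]].
  split=> // [x y z|x y].
    by apply/leib3; rewrite -deltaL2E df.
  apply/der2; rewrite -deltaL1E -delta2E.
  by have /(congr1 (fun h => app2 h x y)) := de; rewrite sqrrN expr1n scale1r.
split; first by split; [apply/multilinear2P | apply/multilinear1P].
congr (_, _); apply: mfunP.
  by case=> [|x [|y [|z []]]] // _; rewrite deltaL2E; apply/leib3/leibf.
case=> [|x [|y []]] // _; rewrite sqrrN expr1n scale1r.
by apply: etrans (proj2 (der2 _ _ _ _ _) (dere x y)); rewrite -deltaL1E -delta2E.
Qed.

Lemma partial1E (t : precochain M 1) :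
  (forall x y, app2 (partial t).1 x y =
     lact x (app1 t y) + ract (app1 t x) y - app1 t (leib_br x y)) /\
  (forall x, app1 (partial t).2 x = ldr_map (app1 t x) - app1 t (ld_der x)).
Proof.
split=> [x y|x]; first exact: deltaL1E.
by rewrite -opprB -delta1E.
Qed.

Lemma cochain2_eq (c c' : precochain M 2) :
  (forall x y, app2 c.1 x y = app2 c'.1 x y) ->
  (forall x, app1 c.2 x = app1 c'.2 x) -> c = c'.
Proof.
case: c c' => [f e] [f' e'] /= eqf eqe; congr (_, _); apply: mfunP.
  by case=> [|x [|y []]].
by case=> [|x []].
Qed.

End LowDegree.

(** * Factor sets of an abelian extension *)

Section Extension.
Variables (K : fieldType) (g : leibDer K) (M : leibDerRep g).
Variable E : abelianExt M.

Notation i := (ext_i E : {linear M -> ext_mid E}).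
Notation p := (ext_p E).

Lemma incl_br m n : leib_br (i m) (i n) = 0.
Proof. by rewrite -(ldhom_br (ext_i E)) linear0. Qed.

Lemma incl_der m : ld_der (i m) = i (ldr_map m).
Proof. by rewrite -(ldhom_der (ext_i E)). Qed.

Lemma proj_incl m : p (i m) = 0.
Proof. by apply/ext_exact; exists m. Qed.

Definition is_section (s : g -> ext_mid E) := forall x, p (s x) = x.

Definition factor_set (s : g -> ext_mid E) (c : precochain M 2) :=
  (forall x y, leib_br (s x) (s y) = s (leib_br x y) + i (app2 c.1 x y)) /\
  (forall x, ld_der (s x) = s (ld_der x) + i (app1 c.2 x)).

(** The retraction [ext_mid E -> M] along [s]: exactness gives a value at each
    [u], and injectivity of [i] makes it linear. *)
Lemma fiber_coordinate (s : {linear g -> ext_mid E}) : is_section s ->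
  exists m : {linear ext_mid E -> M}, forall u, u = s (p u) + i (m u).
Proof.
move=> ps.
have /choice[m mE] u : exists m, u = s (p u) + i m.
  have /ext_exact[m im] : p (u - s (p u)) = 0 by rewrite linearB /= ps subrr.
  by exists m; rewrite im addrC subrK.
have /linear_bundle[m' m'E] : linear m.
  move=> a u v; apply: (@ext_inj _ _ _ E); apply: (addrI (s (p (a *: u + v)))).
  rewrite -mE {1}[u]mE {1}[v]mE !linearP /=.
  by rewrite scalerDr addrACA.
by exists m' => u; rewrite m'E.
Qed.

(** The extension asks that some section induce the given actions; every
    section does, because two sections differ by elements of [i M], on which
    [i M] acts by zero. *)
Lemma section_lact (s : {linear g -> ext_mid E}) x m : is_section s ->
  leib_br (s x) (i m) = i (lact x m).
Proof.
move=> ps; have [s0 [ps0 s0l _]] := ext_split E.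
have [n nE] := fiber_coordinate ps0.
by rewrite [s x]nE ps linearDl /= incl_br addr0 -s0l.
Qed.

Lemma section_ract (s : {linear g -> ext_mid E}) x m : is_section s ->
  leib_br (i m) (s x) = i (ract m x).
Proof.
move=> ps; have [s0 [ps0 _ s0r]] := ext_split E.
have [n nE] := fiber_coordinate ps0.
by rewrite [s x]nE ps linearDr /= incl_br addr0 -s0r.
Qed.

Section Coordinates.
Variables (s : {linear g -> ext_mid E}) (c : precochain M 2).
Hypotheses (ps : is_section s) (sc : factor_set s c).

(** With [der_coordinates], this shows that [c] and the representation
    determine the bracket and the derivation on the whole extension. *)
Lemma br_coordinates x y m n : leib_br (s x + i m) (s y + i n) =
  s (leib_br x y) + i (app2 c.1 x y + (lact x n + ract m y)).
Proof.
rewrite linearDl !linearDr /= sc.1 section_lact // section_ract // incl_br.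
by rewrite addr0 -!addrA !linearD.
Qed.

Lemma der_coordinates x m :
  ld_der (s x + i m) = s (ld_der x) + i (app1 c.2 x + ldr_map m).
Proof. by rewrite linearD sc.2 incl_der -addrA linearD. Qed.

Lemma factor_set_inj c' : factor_set s c' -> c = c'.
Proof.
case=> fc' ec'; apply: cochain2_eq => [x y|x]; apply: (@ext_inj _ _ _ E).
  by apply: (addrI (s (leib_br x y))); rewrite -sc.1 -fc'.
by apply: (addrI (s (ld_der x))); rewrite -sc.2 -ec'.
Qed.

(** Each law of [c] is a law of the extension evaluated on the image of [s]:
    the [s]-parts of the two sides agree by the same law in [g], and what is
    left lies in [i M], where [i] is injective. *)
Lemma factor_set_cocycle : cocycle c.
Proof.
have iI := @ext_inj _ _ _ E.
apply/cocycle2P; split.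
- split=> [y|x] a u v; apply: iI.
  + apply: (addrI (s (leib_br (a *: u + v) y))); rewrite -sc.1.
    rewrite !linearPl !linearP !linearPl /= !sc.1.
    by rewrite scalerDr addrACA.
  + apply: (addrI (s (leib_br x (a *: u + v)))); rewrite -sc.1.
    rewrite !linearPr !linearP /= !sc.1.
    by rewrite scalerDr addrACA.
- move=> a u v; apply: iI.
  apply: (addrI (s (ld_der (a *: u + v)))); rewrite -sc.2.
  by rewrite !linearP /= !sc.2 scalerDr addrACA.
- move=> x y z; apply: iI; apply: (addrI (s (leib_br (leib_br x y) z))).
  have br3l a b d : leib_br (leib_br (s a) (s b)) (s d) =
      s (leib_br (leib_br a b) d)
      + i (app2 c.1 (leib_br a b) d + ract (app2 c.1 a b) d).
    rewrite sc.1 -[s d]addr0 -(linear0 (ext_i E)) br_coordinates.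
    by rewrite linear0r add0r.
  have br3r a b d : leib_br (s a) (leib_br (s b) (s d)) =
      s (leib_br a (leib_br b d))
      + i (app2 c.1 a (leib_br b d) + lact a (app2 c.1 b d)).
    rewrite sc.1 -[s a]addr0 -(linear0 (ext_i E)) br_coordinates.
    by rewrite linear0l addr0.
  rewrite -br3l leib_identity br3l br3r addrACA -linearD -leib_identity.
  by rewrite -linearD.
- move=> x y; apply: iI; apply: (addrI (s (ld_der (leib_br x y)))).
  rewrite -der_coordinates -sc.1 ld_derivation !sc.2.
  rewrite -[s y]addr0 -[s x]addr0 -(linear0 (ext_i E)) !br_coordinates.
  rewrite linear0l linear0r add0r addr0 addrACA -linearD -ld_derivation -linearD.
  by rewrite /=; congr (_ + i _); rewrite addrACA [X in _ + X]addrC [LHS]addrC.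
Qed.

(** In the bracket of [s x + i (t x)] with [s y + i (t y)] the two mixed terms
    give the actions on [t]; rewriting [s (leib_br x y)] as the value of [s'] minus
    [i (t (leib_br x y))] gives the last term of [deltaL t]. *)
Lemma factor_set_shift (s' : {linear g -> ext_mid E}) (t : precochain M 1) :
  (forall x, s' x = s x + i (app1 t x)) -> factor_set s' (c + partial t).
Proof.
move=> s'E; have [dt et] := partial1E t.
split=> [x y|x]; rewrite !s'E.
  have -> : app2 (c + partial t).1 x y =
      app2 c.1 x y + app2 (partial t).1 x y by [].
  rewrite dt br_coordinates -addrA -linearD; congr (_ + i _).
  by rewrite [RHS]addrC -addrA subrK.
have -> : app1 (c + partial t).2 x = app1 c.2 x + app1 (partial t).2 x by [].
rewrite et der_coordinates -addrA -linearD; congr (_ + i _).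
by rewrite [RHS]addrC -addrA subrK.
Qed.

End Coordinates.

Lemma factor_set_exists (s : {linear g -> ext_mid E}) : is_section s ->
  exists c, factor_set s c.
Proof.
move=> ps; have [m mE] := fiber_coordinate ps.
exists ((fun x : {ffun 'I_2 -> g} => m (leib_br (s (x ord0)) (s (x ord_max)))),
        (fun x : {ffun 'I_1 -> g} => m (ld_der (s (x ord0))))).
split=> [x y|x] /=; rewrite !ffunE /=.
  by rewrite [LHS]mE ldhom_br !ps.
by rewrite [LHS]mE ldhom_der ps.
Qed.

Definition factor_sets : set (precochain M 2) :=
  [set c | exists2 s : {linear g -> ext_mid E}, is_section s & factor_set s c].

Lemma factor_sets_nonempty : exists c, factor_sets c.
Proof.
have [s [ps _ _]] := ext_split E; have [c sc] := factor_set_exists ps.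
by exists c; exists s.
Qed.

(** Sections form a torsor under the linear maps [g -> M], and translation by
    [t] becomes translation of the factor set by [partial t]. *)
Lemma factor_sets_coset c : factor_sets c ->
  factor_sets = [set c + b | b in @coboundary _ _ M 2].
Proof.
case=> s ps sc; apply/seteqP; split=> [c' [s' ps' sc']|_ [_ [t lt <-] <-]].
  have [m mE] := fiber_coordinate ps.
  pose t : precochain M 1 := fun x => m (s' (x ord0)).
  exists (partial t).
    by exists t => //; apply/multilinear1P=> a x y; rewrite /t !ffunE /= !linearP.
  apply: (factor_set_inj _ sc'); apply: (factor_set_shift ps sc) => x.
  by rewrite [LHS]mE ps' /t !ffunE.
have /multilinear1P lt1 := lt.
have [s' s'E] : exists s' : {linear g -> ext_mid E},
    s' =1 fun x => s x + i (app1 t x).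
  by apply: linear_bundle => a x y; rewrite lt1 !linearP /= scalerDr addrACA.
exists s'; last exact: factor_set_shift s'E.
by move=> x; rewrite s'E linearD /= ps proj_incl addr0.
Qed.

End Extension.

(** * Classification of extensions by their factor sets *)

Section Classification.
Variables (K : fieldType) (g : leibDer K) (M : leibDerRep g).
Implicit Types E : abelianExt M.

Lemma factor_set_transport E E' (Psi : leibDerHom (ext_mid E) (ext_mid E'))
    (s : {linear g -> ext_mid E}) c :
  (forall m, Psi (ext_i E m) = ext_i E' m) ->
  factor_set s c -> factor_set (Psi \o s) c.
Proof.
move=> Psii [sf se]; split=> [x y|x] /=.
  by rewrite -ldhom_br sf linearD /= Psii.
by rewrite -ldhom_der se linearD /= Psii.
Qed.

(** The equivalence is s x + i m |-> s' x + i' m: in these coordinates both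
    structures are given by the same formulas in [c]. *)
Lemma common_factor_set_equiv E E' c :
  factor_sets E c -> factor_sets E' c -> ext_equiv E E'.
Proof.
case=> s ps sc [s' ps' sc']; have [m mE] := fiber_coordinate ps.
have [Psi PsiE] : exists Psi : {linear ext_mid E -> ext_mid E'},
    Psi =1 fun u => s' (ext_p E u) + ext_i E' (m u).
  by apply: linear_bundle => a u v; rewrite !linearP /= scalerDr addrACA.
have PsiC x n : Psi (s x + ext_i E n) = s' x + ext_i E' n.
  have pu : ext_p E (s x + ext_i E n) = x.
    by rewrite linearD /= ps proj_incl addr0.
  rewrite PsiE pu; congr (_ + ext_i E' _); apply: (@ext_inj _ _ _ E).
  by apply: (addrI (s x)); rewrite [RHS]mE pu.
have Psi_br u v : Psi (leib_br u v) = leib_br (Psi u) (Psi v).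
  rewrite [u]mE [v]mE (br_coordinates ps sc) !PsiC.
  by rewrite (br_coordinates ps' sc').
have Psi_der u : Psi (ld_der u) = ld_der (Psi u).
  by rewrite [u]mE (der_coordinates sc) !PsiC (der_coordinates sc').
exists (LeibDerHom Psi_br Psi_der); split=> [n|u] /=.
  by rewrite -[ext_i E n]add0r -(linear0 s) PsiC linear0 add0r.
by rewrite PsiE linearD /= ps' proj_incl addr0.
Qed.

Lemma ext_equivP E E' : ext_equiv E E' <-> factor_sets E = factor_sets E'.
Proof.
have [c Ec] := factor_sets_nonempty E.
split=> [[Psi [Psii pPsi]]|eqE]; last first.
  by apply: (common_factor_set_equiv Ec); move: (Ec); rewrite eqE.
have E'c : factor_sets E' c.
  case: Ec => s ps sc; exists (Psi \o s); first by move=> x; rewrite /= pPsi.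
  exact: factor_set_transport.
by rewrite (factor_sets_coset Ec) (factor_sets_coset E'c).
Qed.

(** The extension is [g * M] with the formulas of [br_coordinates] and
    [der_coordinates] as definitions, and the section is [x |-> (x, 0)]. *)
Lemma cocycle_extension (c : precochain M 2) :
  cocycle c -> exists E, factor_sets E c.
Proof.
case/cocycle2P=> bf le leibf dere.
pose H : lmodType K := (g * M)%type.
have [br brE] : exists br : {bilinear H -> H -> H}, br =2 fun u v =>
    (leib_br u.1 v.1, app2 c.1 u.1 v.1 + (lact u.1 v.2 + ract u.2 v.1)).
  apply: bilinear_bundle.
  split=> [v|u] a x y; apply: injective_projections => /=.
  - by rewrite linearPl.
  - rewrite (bf.1 v.1) !linearPl /= !scalerDr.
    by rewrite [X in _ + X = _]addrACA [LHS]addrACA.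
  - by rewrite linearPr.
  - rewrite (bf.2 u.1) !linearPr /= !scalerDr.
    by rewrite [X in _ + X = _]addrACA [LHS]addrACA.
have [der derE] : exists der : {linear H -> H}, der =1 fun u =>
    (ld_der u.1, app1 c.2 u.1 + ldr_map u.2).
  apply: linear_bundle => a u v; apply: injective_projections => /=.
    by rewrite linearP.
  by rewrite le !linearP /= scalerDr addrACA.
have br_leib u v w : br (br u v) w = br (br u w) v + br u (br v w).
  case: u v w => [x m] [y n] [z q]; rewrite !brE /=.
  apply: injective_projections => /=; first exact: leib_identity.
  rewrite !(linearDl, linearDr) /=.
  (* Regrouped, both sides are one side of the cocycle equation plus one side
     of each of the three laws of a representation. *)
  rewrite [LHS](AC (1*(1*(1*2))) ((1*3)*(2*(4*5)))) /=.
  rewrite [RHS](AC ((1*(1*(1*2)))*(1*((1*2)*1)))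
    (((1*3)*(6*7))*((4*8)*((2*9)*(5*10))))) /=.
  by rewrite leibf (rep_LLM x y q) (rep_LML x n z) (rep_MLL m y z).
have der_br u v : der (br u v) = br (der u) v + br u (der v).
  case: u v => [x m] [y n]; rewrite !brE !derE /=.
  apply: injective_projections => /=; first exact: ld_derivation.
  rewrite !(linearDl, linearDr, linearD) /= ldr_lact ldr_ract.
  rewrite [LHS](AC (1*(1*2)) ((1*2)*(3*4))) /= dere.
  by rewrite [RHS](AC ((1*(1*2))*(1*(2*1)))
    (((6*3)*(1*5))*((2*7)*(4*8)))) /=.
pose h := @LeibDer K (LeibnizAlg br_leib) der der_br.
have [i0 i0E] : exists i0 : {linear M -> H}, i0 =1 fun m => (0, m).
  apply: linear_bundle => a m n.
  by apply: injective_projections; rewrite /= ?scaler0 ?addr0.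
have [p0 p0E] : exists p0 : {linear H -> g}, p0 =1 fst by exact: linear_bundle.
have [s sE] : exists s : {linear g -> H}, s =1 fun x => (x, 0).
  apply: linear_bundle => a m n.
  by apply: injective_projections; rewrite /= ?scaler0 ?addr0.
have [F FE] := bilinear_bundle bf; have [e eE] := linear_bundle le.
have fr0 x : app2 c.1 x 0 = 0 by rewrite -FE linear0r.
have f0r x : app2 c.1 0 x = 0 by rewrite -FE linear0l.
have e0 : app1 c.2 0 = 0 by rewrite -eE linear0.
have i_br m n : i0 (@leib_br K (rep_pair M) m n) = @leib_br K h (i0 m) (i0 n).
  by rewrite linear0 /= brE !i0E /= f0r !(linear0l, linear0r) !addr0.
have i_der m : i0 (@ld_der K (rep_pair M) m) = @ld_der K h (i0 m).
  by rewrite /= derE !i0E /= e0 linear0 add0r.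
have p_br u v : p0 (@leib_br K h u v) = leib_br (p0 u) (p0 v).
  by rewrite /= brE !p0E.
have p_der u : p0 (@ld_der K h u) = ld_der (p0 u) by rewrite /= derE !p0E.
have p_surj x : exists u, p0 u = x by exists (x, 0); rewrite p0E.
have i_inj : injective i0 by move=> m n; rewrite !i0E => -[].
have p_exact u : p0 u = 0 <-> exists m, i0 m = u.
  rewrite p0E; split=> [u0|[m <-]]; last by rewrite i0E.
  by exists u.2; rewrite i0E -u0 -surjective_pairing.
have ps x : p0 (s x) = x by rewrite p0E sE.
have s_split : exists s : {linear g -> H},
    [/\ forall x, p0 (s x) = x,
        forall x m, i0 (lact x m) = br (s x) (i0 m)
      & forall m x, i0 (ract m x) = br (i0 m) (s x)].
  exists s; split=> // [x m|m x]; rewrite !i0E sE brE /=.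
    by rewrite fr0 !linear0r addr0 add0r.
  by rewrite f0r !linear0l !add0r.
pose E := @AbelianExt K g M h (@LeibDerHom K (rep_pair M) h i0 i_br i_der)
  (@LeibDerHom K h g p0 p_br p_der) i_inj p_exact p_surj s_split.
exists E, s; first exact: ps.
split=> [x y|x] /=; rewrite ?brE ?derE !sE i0E;
  apply: injective_projections => /=.
- by rewrite addr0.
- by rewrite linear0l linear0r !add0r !addr0.
- by rewrite addr0.
- by rewrite linear0 add0r addr0.
Qed.

End Classification.

(** * The bijection *)

Theorem theorem4p9 (K : fieldType) (charK0 : [pchar K]%R =i pred0)
    (g : leibDer K) (M : leibDerRep g) :
  exists F : Ext M -> cohomology M 2, bijective F.
Proof.
have class_of (A : Ext M) : exists E, sval A = ext_equiv E by case: A.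
(* Both maps are defined by predicates, so that no representative of a class
   has to be chosen. *)
pose F0 (A : Ext M) : set (precochain M 2) :=
  [set c | exists2 E, sval A E & factor_sets E c].
have F0E A E : sval A = ext_equiv E -> F0 A = factor_sets E.
  move=> AE; apply/seteqP; split=> [c [E']|c Ec].
    by rewrite AE => /ext_equivP->.
  by exists E => //; rewrite AE; apply/ext_equivP.
have F0P A : exists2 c, cocycle c &
    F0 A = [set c + b | b in @coboundary _ _ M 2].
  have [E AE] := class_of A; have [c Ec] := factor_sets_nonempty E.
  exists c; last by rewrite (F0E _ _ AE) (factor_sets_coset Ec).
  by case: Ec => s ps sc; exact: factor_set_cocycle sc.
pose G0 (C : cohomology M 2) E := factor_sets E = sval C.
have G0E C E : G0 C E -> G0 C = ext_equiv E.
  move=> CE; apply/funext => E'; apply/propext.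
  by rewrite ext_equivP /G0 -CE; split.
have G0P C : exists E, G0 C = ext_equiv E.
  case: (C) => B [c cZ BE]; have [E Ec] := cocycle_extension cZ.
  by exists E; apply: G0E; rewrite /G0 (factor_sets_coset Ec) /= BE.
exists (fun A => exist _ (F0 A) (F0P A)).
have sval_inj T (P : T -> Prop) (a b : {x | P x}) : sval a = sval b -> a = b.
  case: a b => [x Px] [y Py] /= exy; subst y.
  by congr exist; apply: Prop_irrelevance.
exists (fun C => exist _ (G0 C) (G0P C)) => [A|C]; apply: sval_inj => /=.
  have [E AE] := class_of A; rewrite AE.
  by apply: G0E; rewrite /G0 /= (F0E _ _ AE).
have [E CE] := G0P C.
rewrite (F0E _ E) //=.
by have : ext_equiv E E; [exact/ext_equivP | rewrite -CE].
Qed.
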